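(* For any DAG $G=(V,E)$ there is a hyperplane arrangement $\mathcal{H}_G\subseteq\mathbb{R}^E$ such that for every $C\in\mathbb{R}^E\setminus\mathcal{H}_G$ the set $$\operatorname{cone}_G(C):=\{C'\in\mathbb{R}^E\setminus\mathcal{H}_G : \mathcal{M}_*(G,C)=\mathcal{M}_*(G,C')\}$$ is a full-dimensional open polyhedral cone. The collection of all closures of such cones for fixed $G$ (together with their faces) forms a complete polyhedral fan $\mathcal{F}_G$ in $\mathbb{R}^E$. Moreover, the map $\Phi$ which sends a cone of $\mathcal{F}_G$ to its maxoid is an inclusion-reversing surjection onto the set of maxoids $\{\mathcal{M}_*(G,C): C\in\mathbb{R}^E\}$ of $G$; here inclusion-reversing means that if $F_1,F_2\in\mathcal{F}_G$ and $F_1$ is a face of $F_2$, then $\Phi(F_1)\supseteq\Phi(F_2)$.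
   Context: Let $G=(V,E)$ be a finite DAG. $\mathbb{R}^E$ denotes the set of weight matrices supported on $G$: $V\times V$ matrices $C=(c_{ij})$ with $c_{ij}\in\mathbb{R}$ if $i\to j\in E$ and $c_{ij}=-\infty$ otherwise (identified with the Euclidean space indexed by $E$). For distinct $i,j\in V$, $P(i,j)$ is the set of directed paths from $i$ to $j$ in $G$, and the weight of a path $\pi$ is $\omega_C(\pi)=\sum_{e\in\pi}c_e$. A path in $P(i,j)$ is critical (for $(G,C)$) if its weight is maximal among all paths in $P(i,j)$. $C$ is generic if for all distinct $i,j$ with $P(i,j)\neq\emptyset$ there is exactly one critical path from $i$ to $j$. A hyperplane arrangement is a finite collection of linear hyperplanes, identified with the union of its members where it is treated as a subset of $\mathbb{R}^E$. The arrangement $\mathcal{H}_G$ meant in the claim is the one whose complement $\mathbb{R}^E\setminus\mathcal{H}_G$ is the set of generic weight matrices; its hyperplanes are given by equations of the form $\omega_C(\pi)=\omega_C(\pi')$ with distinct $\pi,\pi'\in P(i,j)$. For $L\subseteq V$, the critical DAG $G^*_{C,L}$ is the DAG on $V$ with an edge $i\to j$ ($i\neq j$) if and only if $P(i,j)\neq\emptyset$ and no critical path from $i$ to $j$ in $(G,C)$ has an interior node in $L$. Distinct $i,j\in V\setminus L$ are $C^*$-connected given $L$ if $G^*_{C,L}$ contains, up to exchanging $i$ and $j$, a path of one of the forms (a) $i\to j$; (b) $i\leftarrow p\to j$; (c) $i\to \ell\leftarrow j$; (d) $i\leftarrow p\to\ell\leftarrow j$; (e) $i\leftarrow p\to\ell\leftarrow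 q\to j$, with $\ell\in L$ and $p,q\notin L$. Otherwise they are $C^*$-separated given $L$. For pairwise disjoint $I,J,L\subseteq V$, $I$ and $J$ are $C^*$-separated given $L$ if every $i\in I$ and $j\in J$ are $C^*$-separated given $L$. The maxoid $\mathcal{M}_*(G,C)$ is the set of all CI statements $[I\perp\!\!\!\perp J\mid L]$ with $I,J,L$ pairwise disjoint such that $I$ and $J$ are $C^*$-separated given $L$ in $(G,C)$. An open polyhedral cone is a finite intersection of open linear half-spaces (possibly the whole space); a polyhedral cone is a finite intersection of closed linear half-spaces. Closures are Euclidean closures. A polyhedral fan is a finite collection of non-empty polyhedral cones closed under taking non-empty faces and such that the intersection of any two cones is a face of both; it is complete if its cones cover the space. The maxoid of a cone $F\in\mathcal{F}_G$ is $\Phi(F)=\mathcal{M}_*(G,C)$ for $C$ in the relative interior of $F$.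
   Formalization: H_G is not the full union of the hyperplanes ω_C(π)=ω_C(π') but the part of them where both tied paths are critical, i.e. the set of non-generic matrices; with three parallel paths between two nodes no union of hyperplanes satisfies the claim. *)

(* Defs.v *)
From mathcomp Require Import all_boot all_order all_algebra.
From mathcomp Require Import all_classical all_reals all_analysis.

Set Implicit Arguments.
Unset Strict Implicit.
Unset Printing Implicit Defensive.

Import Order.TTheory GRing.Theory Num.Theory.
Import numFieldNormedType.Exports.

Local Open Scope classical_set_scope.
Local Open Scope ring_scope.

Section ConvexGeometry.
Context {R : realType} {n : nat}.
Implicit Types (a x : 'rV[R]_n) (K F : set 'rV[R]_n).

Definition dot a x : R := \sum_k a 0 k * x 0 k.

Definition linear_hyperplane (H : set 'rV[R]_n) : Prop :=
  exists2 a, a != 0 & H = [set x | dot a x = 0].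

Definition hyperplane_arrangement (A : set (set 'rV[R]_n)) : Prop :=
  finite_set A /\ (forall H, A H -> linear_hyperplane H).

Definition open_polyhedral_cone K : Prop :=
  exists2 s : seq 'rV[R]_n,
    0 \notin s & K = [set x | forall a, a \in s -> 0 < dot a x].

Definition polyhedral_cone K : Prop :=
  exists2 s : seq 'rV[R]_n,
    0 \notin s & K = [set x | forall a, a \in s -> 0 <= dot a x].

Definition affine_hull K : set 'rV[R]_n :=
  [set x | exists (m : nat) (c : 'I_m -> R) (y : 'I_m -> 'rV[R]_n),
     [/\ forall k, K (y k), \sum_k c k = 1 & x = \sum_k c k *: y k]].

Definition full_dimensional K : Prop := affine_hull K = setT.

Definition relative_interior K : set 'rV[R]_n :=
  [set x | K x /\ \forall y \near x, affine_hull K y -> K y].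

(* The inequality may be trivial, so K is a face of itself and the empty set
   is a face of K. *)
Definition is_face F K : Prop :=
  exists (a : 'rV[R]_n) (b : R),
    (forall x, K x -> dot a x <= b) /\ F = K `&` [set x | dot a x = b].

Definition polyhedral_fan (FF : set (set 'rV[R]_n)) : Prop :=
  [/\ finite_set FF,
      forall K, FF K -> polyhedral_cone K /\ K !=set0,
      forall K F, FF K -> is_face F K -> F !=set0 -> FF F &
      forall K1 K2, FF K1 -> FF K2 ->
        is_face (K1 `&` K2) K1 /\ is_face (K1 `&` K2) K2].

Definition complete_polyhedral_fan (FF : set (set 'rV[R]_n)) : Prop :=
  polyhedral_fan FF /\ \bigcup_(K in FF) K = setT.

End ConvexGeometry.

(* A finite DAG is a finite type V of nodes with a relation e that has no
   nonempty directed cycle (in particular no loop). *)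
Definition acyclic (V : finType) (e : rel V) : Prop :=
  forall c : seq V, cycle e c -> c = [::].

Notation arc e := {a | e a.1 a.2}.

(* The Euclidean space R^E: row vectors with one coordinate per edge, edges
   being numbered by enum_rank. *)
Notation weights R e := 'rV[R]_#|{: arc e}|.

(* The triple (A, B, L) encodes the CI statement [A _||_ B | L]. *)
Definition ci_statement (V : finType) : Type := ({set V} * {set V} * {set V})%type.

Section Maxoids.
Context {R : realType} {V : finType} (e : rel V).
Implicit Types (C : weights R e) (i j : V) (p q : seq V) (L : {set V}).

(* The entry c_ij of the weight matrix encoded by C. *)
Definition entry C i j : \bar R :=
  if insub (i, j) is Some a then (C 0 (enum_rank (a : arc e)))%:E else -oo%E.

(* As in path.v, a directed path is given by its first node i and the sequence
   p of the nodes that follow it. *)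
Definition dpath i j p : bool := path e i p && (last i p == j).

Definition path_weight C i p : \bar R :=
  (\sum_(a <- zip (belast i p) p) entry C a.1 a.2)%E.

Definition interior_nodes i p : seq V := behead (belast i p).

Definition critical C i j p : Prop :=
  dpath i j p /\
  forall q, dpath i j q -> (path_weight C i q <= path_weight C i p)%E.

Definition generic C : Prop :=
  forall i j, i != j -> (exists p, dpath i j p) -> exists! p, critical C i j p.

Definition critical_dag C L i j : Prop :=
  [/\ i != j, exists p, dpath i j p &
      forall p, critical C i j p ->
        forall k, k \in interior_nodes i p -> k \notin L].

Definition cstar_path C L i j : Prop :=
  let g := critical_dag C L in
  [\/ g i j,
      exists p : V, [/\ p \notin L, uniq [:: i; p; j], g p i & g p j],
      exists l, [/\ l \in L, uniq [:: i; l; j], g i l & g j l] |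
      (exists p l : V, [/\ p \notin L, l \in L & uniq [:: i; p; l; j]] /\
                   [/\ g p i, g p l & g j l]) \/
      (exists p l q : V,
        [/\ p \notin L, l \in L, q \notin L & uniq [:: i; p; l; q; j]] /\
        [/\ g p i, g p l, g q l & g q j])].

Definition cstar_connected C L i j : Prop :=
  cstar_path C L i j \/ cstar_path C L j i.

Definition cstar_separated C (A B L : {set V}) : Prop :=
  forall i j, i \in A -> j \in B -> ~ cstar_connected C L i j.

Definition maxoid C : set (ci_statement V) :=
  [set s : ci_statement V | let: (A, B, L) := s in
     [/\ [disjoint A & B]%B, [disjoint A & L]%B & [disjoint B & L]%B] /\
     cstar_separated C A B L].

Definition tie i p q : set (weights R e) :=
  [set C | path_weight C i p = path_weight C i q].

Definition path_ties : set (set (weights R e)) :=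
  [set H | exists i j p q,
     [/\ i != j, dpath i j p, dpath i j q, p != q & H = tie i p q]].

(* The subset of R^E cut out by an arrangement of tie hyperplanes: the tie of
   two paths from i to j counts only where both are critical.  If i and j are
   joined by three or more paths, this can be a proper part of the union of the
   hyperplanes: a tie between two paths that are beaten by a third one does not
   violate genericity, and does not change the maxoid. *)
Definition critical_locus (A : set (set (weights R e))) : set (weights R e) :=
  [set C | exists i j p q,
     [/\ i != j, p != q, critical C i j p, critical C i j q & A (tie i p q)]].

Definition maxoid_cone (HG : set (weights R e)) C : set (weights R e) :=
  [set C' | ~ HG C' /\ maxoid C = maxoid C'].

(* Every closure is a face of itself. *)
Definition maxoid_fan (HG : set (weights R e)) : set (set (weights R e)) :=
  [set F | F !=set0 /\
     exists2 C, ~ HG C & is_face F (closure (maxoid_cone HG C))].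

End Maxoids.

Arguments path_ties {R V} e.

(* Main.v *)
(** Encode each path by the indicator vector of its edges, so that the weight of
    a path is a linear functional of C.  The critical paths at C are those that
    maximize this functional among the paths with the same end points, and the
    set of matrices at which all paths of a given critical set stay critical is a
    polyhedral cone.  These cones form the normal fan of the Minkowski sum, over
    all pairs (i, j), of the path polytopes conv P(i, j); their relative
    interiors are the classes of matrices with the same critical paths, and the
    full-dimensional ones belong to the generic matrices.

    It remains to see that a generic maxoid determines its critical paths.  If
    the critical paths from i to j in C and C' differ, cut off the common initial
    part, so that their first steps x and x' are different.  By acyclicity one may
    assume that x does not reach x'.  Conditioning on x' and all its ancestors but
    i, the nodes i and j are connected in C but separated in C'.  Conversely, more
    critical paths give fewer edges of the critical DAG, hence a larger maxoid. *)

Require Import Defs.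
From mathcomp Require Import all_boot all_order all_algebra.
From mathcomp Require Import all_classical all_reals all_analysis.

Local Open Scope classical_set_scope.


(** * Linear functionals, small perturbations and affine hulls *)

Section Perturbation.
Set Implicit Arguments.
Unset Strict Implicit.
Local Open Scope ring_scope.
Import Order.TTheory GRing.Theory Num.Theory numFieldNormedType.Exports.
Context {R : realType} {n : nat}.
Implicit Types (a x y z : 'rV[R]_n) (s : seq 'rV[R]_n) (K : set 'rV[R]_n).

Lemma dotDr a x y : dot a (x + y) = dot a x + dot a y.
Proof.
by rewrite /dot -big_split /=; apply: eq_bigr => k _; rewrite mxE mulrDr.
Qed.

Lemma dotZr a (c : R) x : dot a (c *: x) = c * dot a x.
Proof.
by rewrite /dot mulr_sumr; apply: eq_bigr => k _; rewrite mxE mulrCA.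
Qed.

Lemma dotC a x : dot a x = dot x a.
Proof. by apply: eq_bigr => k _; rewrite mulrC. Qed.

Lemma dotNr a x : dot a (- x) = - dot a x.
Proof. by rewrite -scaleN1r dotZr mulN1r. Qed.

Lemma dotBr a x y : dot a (x - y) = dot a x - dot a y.
Proof. by rewrite dotDr dotNr. Qed.

Lemma dotDl a x y : dot (x + y) a = dot x a + dot y a.
Proof. by rewrite dotC dotDr !(dotC a). Qed.

Lemma dotZl a (c : R) x : dot (c *: x) a = c * dot x a.
Proof. by rewrite dotC dotZr dotC. Qed.

Lemma dotBl a x y : dot (x - y) a = dot x a - dot y a.
Proof. by rewrite dotC dotBr !(dotC a). Qed.

Lemma dot0l a : dot 0 a = 0.
Proof. by rewrite -(scale0r 0) dotZl mul0r. Qed.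

Lemma dot_sumr (I : Type) (r : seq I) (P : pred I) (F : I -> 'rV[R]_n) a :
  dot a (\sum_(i <- r | P i) F i) = \sum_(i <- r | P i) dot a (F i).
Proof.
by apply: (big_morph _ (dotDr a)); rewrite dotC dot0l.
Qed.

Lemma dot_suml (I : Type) (r : seq I) (P : pred I) (F : I -> 'rV[R]_n) a :
  dot (\sum_(i <- r | P i) F i) a = \sum_(i <- r | P i) dot (F i) a.
Proof. by rewrite dotC dot_sumr; apply: eq_bigr => i _; rewrite dotC. Qed.

Lemma dot_gt0 a : a != 0 -> 0 < dot a a.
Proof.
move=> a0; rewrite lt0r sumr_ge0 ?andbT => [|k _]; last by rewrite -expr2 sqr_ge0.
apply: contraNneq a0 => /eqP.
rewrite psumr_eq0 => [|k _]; last by rewrite -expr2 sqr_ge0.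
move=> /allP h; apply/eqP/rowP => k; rewrite mxE; apply/eqP.
by have := h k (mem_index_enum k); rewrite mulf_eq0 orbb.
Qed.

Lemma dot_continuous a : continuous (dot a).
Proof.
refine (@continuous_big R^o _ +%R 0 xpredT (@add_continuous R^o) _ _
  (fun k x => a 0 k * x 0 k) _) => k _ x.
exact: (@cvgM R _ (nbhs x) _ (fun=> a 0 k) _ _ _
  (cvg_cst _) (@coord_continuous R 1 n 0 k x)).
Qed.

Lemma near_dot_gt0 s x : (forall a, a \in s -> 0 < dot a x) ->
  \forall y \near x, forall a, a \in s -> 0 < dot a y.
Proof.
elim: s => [|a s IH] h; first exact: (filterE (F := nbhs x)).
have h1 : \forall y \near x, 0 < dot a y.
  exact: (cvgr_gt _ (@dot_continuous a x) _ (h a (mem_head a s))).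
have h2 : \forall y \near x, forall b, b \in s -> 0 < dot b y.
  by apply: IH => b bs; apply: h; rewrite inE bs orbT.
by apply: filterS2 h1 h2 => y y1 y2 b; rewrite inE => /predU1P[->|/y2].
Qed.

Lemma nbhs_ray x y K : nbhs x K -> exists2 c : R, 0 < c & K (x + c *: y).
Proof.
move=> Kx.
have : (x + c *: y) @[c --> (0 : R)] --> x.
  rewrite -[X in _ --> X]addr0 -(scale0r y).
  by apply: cvgD; [exact: cvg_cst|apply: cvgZr_tmp; exact: cvg_id].
move=> /(_ K Kx) /nbhs_ballP[c /= c0 h]; exists (c / 2); first by rewrite divr_gt0.
apply: h; rewrite /ball /= sub0r normrN gtr0_norm ?divr_gt0//.
by rewrite ltr_pdivrMr// ltr_pMr// ltr1n.
Qed.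

(** If [z] lies on the hyperplane of the new [a], a small step along [a] leaves it without reaching
    any of the other hyperplanes. *)
Lemma avoid_hyperplanes s : 0 \notin s ->
  exists z, forall a, a \in s -> dot a z != 0.
Proof.
elim: s => [|a s IH]; first by exists 0.
rewrite inE negb_or eq_sym => /andP[a0 /IH[z hz]].
have [az|az] := eqVneq (dot a z) 0; last first.
  by exists z => b; rewrite inE => /predU1P[->//|/hz].
(* Scaling [b] by [dot b z] turns nonvanishing at [z] into positivity, which persists nearby. *)
have /near_dot_gt0/(nbhs_ray a)[c c0 hc] :
    forall b, b \in [seq dot b z *: b | b <- s] -> 0 < dot b z.
  by move=> _ /mapP[b bs ->]; rewrite dotZl -expr2 exprn_even_gt0 ?hz.
exists (z + c *: a) => b; rewrite inE => /predU1P[->|bs].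
  by rewrite dotDr az add0r dotZr gt_eqF// mulr_gt0// dot_gt0.
have := hc _ (map_f (fun b => dot b z *: b) bs); rewrite dotZl => /gt_eqF.
by apply: contraFneq => ->; rewrite mulr0.
Qed.

Lemma affine_hull_line K x z (c : R) : K x -> K z ->
  affine_hull K (x + c *: (z - x)).
Proof.
move=> Kx Kz.
exists 2%N, (fun i => if i == ord0 then 1 - c else c),
  (fun i => if i == ord0 then x else z); split.
- by move=> k; case: ifP.
- by rewrite big_ord_recl big_ord1 /= subrK.
- by rewrite big_ord_recl big_ord1 /= scalerBl scale1r scalerBr addrA addrAC.
Qed.

Lemma nbhs_full_dimensional K x : nbhs x K -> full_dimensional K.
Proof.
move=> Kx; apply/seteqP; split=> // y _.
have [c c0 Kc] := nbhs_ray (y - x) Kx.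
have := affine_hull_line c^-1 (nbhs_singleton Kx) Kc.
by rewrite [x + c *: _]addrC addrK scalerA mulVf ?gt_eqF// scale1r addrC subrK.
Qed.

Lemma affine_hull_dot_eq0 K a : (forall y, K y -> dot a y = 0) ->
  forall y, affine_hull K y -> dot a y = 0.
Proof.
move=> h _ [m [c [y [Ky _ ->]]]].
by rewrite dot_sumr big1// => k _; rewrite dotZr h// mulr0.
Qed.

End Perturbation.


(** * Normal fans of Minkowski sums of polytopes *)

Section NormalFan.
Set Implicit Arguments.
Unset Strict Implicit.
Local Open Scope ring_scope.
Import Order.TTheory GRing.Theory Num.Theory numFieldNormedType.Exports.
Context {R : realType} {n : nat} {T : finType} (r : rel T) (v : T -> 'rV[R]_n).
Hypotheses (r_refl : reflexive r) (r_sym : symmetric r) (r_trans : transitive r).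
Hypothesis v_inj : forall t u, r t u -> v t = v u -> t = u.
Implicit Types (x y z : 'rV[R]_n) (t u : T) (S : {set T}).

(** Each class of [r] spans a polytope, the convex hull of its vectors [v t]. Taken over all classes
    at once, the maximizers encode the face of the Minkowski sum on which [x] is maximal. *)
Definition maximizers x : {set T} :=
  finset (fun t => [forall u, r t u ==> (dot (v u) x <= dot (v t) x)]).

Definition normal_cone S : set 'rV[R]_n := [set x | S \subset maximizers x].

Definition generic_for x : Prop :=
  {in maximizers x &, forall t u, r t u -> t = u}.

Definition normal_fan : set (set 'rV[R]_n) :=
  range (fun x => normal_cone (maximizers x)).

Let top x t : T := [arg max_(u > t | r t u) dot (v u) x]%O.

Lemma maximizersP x t :
  reflect (forall u, r t u -> dot (v u) x <= dot (v t) x) (t \in maximizers x).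
Proof.
rewrite inE; apply: (iffP forallP) => h u; last by apply/implyP/h.
by move=> tu; have /implyP := h u; exact.
Qed.

Let top_rel x t : r t (top x t).
Proof.
by rewrite /top; case: Order.TotalTheory.arg_maxP => [|//]; exact: r_refl.
Qed.

Let top_max x t : top x t \in maximizers x.
Proof.
apply/maximizersP; rewrite /top.
case: Order.TotalTheory.arg_maxP => [|u tu h w uw]; first exact: r_refl.
by apply: h; exact: r_trans uw.
Qed.

Lemma exists_maximizer x t : exists2 u, r t u & u \in maximizers x.
Proof. by exists (top x t). Qed.

Lemma maximizer_le x t u : u \in maximizers x -> r t u -> dot (v t - v u) x <= 0.
Proof. by move=> /maximizersP h tu; rewrite dotBl subr_le0 h// r_sym. Qed.

Lemma mem_maximizers x t u : u \in maximizers x -> r t u ->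
  (t \in maximizers x) = (dot (v t - v u) x == 0).
Proof.
move=> ux tu; rewrite eq_le maximizer_le//= dotBl subr_ge0.
apply/maximizersP/idP => [->//|tx w tw].
by apply: le_trans tx; move/maximizersP: ux; apply; apply: r_trans tw; rewrite r_sym.
Qed.

Lemma notin_maximizers x t : t \notin maximizers x -> 0 < dot (v (top x t) - v t) x.
Proof.
move=> tx; rewrite -opprB -scaleN1r dotZl mulN1r oppr_gt0 lt_neqAle.
by rewrite -mem_maximizers ?tx ?maximizer_le.
Qed.

(** Each non-maximizer loses strictly to the [top] of its class, and finitely many strict
    inequalities persist near [x]. *)
Lemma near_maximizers x : \forall y \near x, maximizers y \subset maximizers x.
Proof.
have /near_dot_gt0 : forall a,
    a \in [seq v (top x t) - v t | t <- enum (~: maximizers x)%SET] -> 0 < dot a x.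
  by move=> _ /mapP[t + ->]; rewrite mem_enum inE; exact: notin_maximizers.
apply: filterS => y h; apply/fintype.subsetP => t ty; apply: contraT => tx.
have := h (v (top x t) - v t) (map_f (fun t => v (top x t) - v t) _).
rewrite mem_enum inE => /(_ tx); rewrite dotBl subr_gt0.
by move/maximizersP: ty => /(_ _ (top_rel x t)); rewrite leNgt => /negP.
Qed.

(** A small step in a direction on which no nonzero difference of the [v t] vanishes breaks all ties
    and creates no new maximizer. *)
Lemma exists_generic x : exists2 y, generic_for y & maximizers y \subset maximizers x.
Proof.
have [|z hz] := @avoid_hyperplanes _ _
  [seq a <- [seq v p.1 - v p.2 | p : T * T] | a != 0].
  by rewrite mem_filter eqxx.
have [c c0 hc] := nbhs_ray z (near_maximizers x).
exists (x + c *: z) => // t u ty uy tu.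
have tx := fintype.subsetP hc t ty; have ux := fintype.subsetP hc u uy.
have txu : dot (v t - v u) x = 0 by apply/eqP; rewrite -mem_maximizers.
have : dot (v t - v u) (x + c *: z) == 0 by rewrite -mem_maximizers.
rewrite dotDr dotZr txu add0r mulf_eq0 gt_eqF//= => /negPn tz.
apply: v_inj => //; apply/eqP; apply: contraNT tz; rewrite -subr_eq0 => tu0.
by apply: hz; rewrite mem_filter tu0; apply/mapP; exists (t, u); rewrite ?mem_enum.
Qed.

Lemma polyhedral_normal_cone S : polyhedral_cone (normal_cone S).
Proof.
exists [seq a <- [seq v p.1 - v p.2 |
  p <- enum [pred p | (p.1 \in S) && r p.1 p.2]] | a != 0].
  by rewrite mem_filter eqxx.
apply/seteqP; split => x /=.
  move=> /fintype.subsetP Sx a; rewrite mem_filter => /andP[_ /mapP[[t u] + ->]].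
  rewrite mem_enum inE /= => /andP[tS tu].
  by rewrite dotBl subr_ge0; move/maximizersP: (Sx t tS) => /(_ u tu).
move=> h; apply/fintype.subsetP => t tS; apply/maximizersP => u tu.
rewrite -subr_ge0 -dotBl; have [->|tu0] := eqVneq (v t - v u) 0; first by rewrite dot0l.
apply: h; rewrite mem_filter tu0.
by apply/mapP; exists (t, u); rewrite // mem_enum inE /= tS.
Qed.

(** On the cone of [x] each summand of [a] is nonpositive, because [top x t] stays maximal there. So
    [a] vanishes exactly where every summand does, that is, where all of [S] is maximal. *)
Lemma face_normal_coneI x S :
  is_face (normal_cone (maximizers x) `&` normal_cone S) (normal_cone (maximizers x)).
Proof.
pose a := \sum_(t in S) (v t - v (top x t)).
have le0 y t : normal_cone (maximizers x) y -> dot (v t - v (top x t)) y <= 0.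
  move=> /fintype.subsetP xy.
  by apply: maximizer_le; [apply: xy; exact: top_max|exact: top_rel].
exists a, 0; split=> [y xy|].
  by rewrite dot_suml; apply: sumr_le0 => t _; exact: le0.
apply/seteqP; split=> y /= [xy]; rewrite dot_suml.
  move=> /fintype.subsetP Sy; split => //; apply: big1 => t /Sy ty; apply/eqP.
  by rewrite -mem_maximizers//; move/fintype.subsetP: xy; apply.
move=> /eqP; rewrite -oppr_eq0 -sumrN psumr_eq0 => [/allP h|t _]; last first.
  by rewrite oppr_ge0 le0.
split=> //; apply/fintype.subsetP => t tS; rewrite (@mem_maximizers _ _ (top x t))//.
  by have := h t (mem_index_enum t); rewrite tS oppr_eq0.
by move/fintype.subsetP: xy; apply.
Qed.

(** [top x t] is maximal at [y], at [z] and hence at [y + z]. The deficits of [t] against it have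
    one sign and add up, so their sum vanishes only if both do. *)
Lemma normal_coneD x y z : normal_cone (maximizers x) y -> normal_cone (maximizers x) z ->
  maximizers (y + z) = (maximizers y :&: maximizers z)%SET.
Proof.
move=> /fintype.subsetP xy /fintype.subsetP xz; apply/setP => t; rewrite finset.in_setI.
have hy := xy _ (top_max x t); have hz := xz _ (top_max x t).
have ty := @mem_maximizers y t _ hy (top_rel x t).
have tz := @mem_maximizers z t _ hz (top_rel x t).
rewrite (@mem_maximizers _ t (top x t))//; last first.
  by apply/maximizersP => u tu; rewrite !dotDr lerD//; exact/maximizersP/tu.
rewrite ty tz dotDr.
have le_y := maximizer_le hy (top_rel x t); have le_z := maximizer_le hz (top_rel x t).
by rewrite -oppr_eq0 opprD paddr_eq0 ?oppr_ge0// !oppr_eq0.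
Qed.

Lemma maximizersZ (c : R) x : 0 < c -> maximizers (c *: x) = maximizers x.
Proof.
move=> c0; apply/setP => t; rewrite !inE; apply: eq_forallb => u.
by rewrite !dotZr ler_pM2l.
Qed.

(* The point y is chosen in F with as few maximizers as possible, so that it
   lies in the relative interior of F; the supporting functional of F vanishes
   on the rest of the cone of y because y can be moved slightly away from any
   of its points. *)
Lemma face_normal_cone x F : is_face F (normal_cone (maximizers x)) -> F !=set0 ->
  exists2 y, maximizers x \subset maximizers y & F = normal_cone (maximizers y).
Proof.
move=> [a [b [ab ->]]] [y0 [xy0 /= ay0]].
(* The cone is stable under positive scaling and [b] is attained at [y0]; scaling by 2 and by 1/2
   forces [b = 0]. *)
have b0 : b = 0.
  apply/eqP; rewrite eq_le.
  have h c : 0 < c -> c * b <= b.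
    by move=> c0; rewrite -{1}ay0 -dotZr ab// /normal_cone /= maximizersZ.
  have := h 2 (ltr0n _ 2); have := h 2^-1; rewrite invr_gt0 ltr0n => /(_ isT).
  by rewrite ler_pdivrMl ?ltr0n// mulr_natl mulr2n gerDl lerDl => -> ->.
rewrite {}b0 in ab ay0 *; set F' := _ `&` _.
have [|k /asboolP[y Fy <-] kmin] :=
    @ex_minnP (fun k => `[< exists2 y, F' y & #|maximizers y| = k >]).
  by exists #|maximizers y0|; apply/asboolP; exists y0.
have [xy /= ay] := Fy; exists y => //; apply/seteqP; split => z.
  move=> [xz /= az]; rewrite /normal_cone /=.
  have yz := normal_coneD xy xz.
  have : (maximizers y :&: maximizers z)%SET == maximizers y.
    rewrite eqEcard finset.subsetIl -yz kmin//; apply/asboolP; exists (y + z) => //.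
    by split; rewrite /= ?dotDr ?ay ?az ?addr0// /normal_cone /= yz finset.subsetI xy.
  by move=> /eqP <-; exact: finset.subsetIr.
rewrite /normal_cone /= => yz.
have xz : maximizers x \subset maximizers z by exact: fintype.subset_trans yz.
split => //=; apply/eqP; rewrite eq_le ab//=.
have [c c0 hc] := nbhs_ray (- z) (near_maximizers y).
suff : dot a (y + c *: - z) <= 0.
  by rewrite dotDr ay add0r dotZr dotNr pmulr_rle0// oppr_le0.
apply: ab; rewrite /normal_cone /=; apply/fintype.subsetP => t tx.
have ty := fintype.subsetP xy t tx.
apply/maximizersP => u tu; rewrite -subr_ge0 -dotBl.
have [uy|uy] := boolP (u \in maximizers y).
  have : dot (v t - v u) y == 0 by rewrite -mem_maximizers.
  have : dot (v t - v u) z == 0.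
    by rewrite -mem_maximizers//; [exact: (fintype.subsetP xz)|exact: (fintype.subsetP yz)].
  by rewrite dotDr dotZr dotNr => /eqP -> /eqP ->; rewrite oppr0 mulr0 addr0.
(* If [u] is not maximal at [y], the comparison goes through the best [w] of its class at the moved
   point: [w] ties with [t] at [y] and at [z], and beats [u]. *)
have uyc : u \notin maximizers (y + c *: - z).
  by apply: contra uy; exact: (fintype.subsetP hc).
have uc := notin_maximizers uyc.
have topy := fintype.subsetP hc _ (top_max (y + c *: - z) u).
set w := top (y + c *: - z) u in uc topy.
have tw : r t w by apply: r_trans tu _; exact: top_rel.
have : dot (v t - v w) y == 0 by rewrite -mem_maximizers.
have : dot (v t - v w) z == 0.
  by rewrite -mem_maximizers//; [exact: (fintype.subsetP xz)|exact: (fintype.subsetP yz)].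
have -> : v t - v u = (v t - v w) + (v w - v u) by rewrite addrA subrK.
move=> /eqP wz /eqP wy; rewrite dotDl [dot (v t - v w) (_ + _)]dotDr dotZr dotNr.
by rewrite wz wy oppr0 mulr0 !add0r ltW.
Qed.

(** A relative interior point [y] can be pushed slightly further away from [x] within the cone; a
    maximizer at [y] but not at [x] would then overtake those at [x]. Conversely, nearby points only
    lose maximizers, and ties among those at [x] persist on the affine hull. *)
Lemma relative_interior_normal_cone x :
  relative_interior (normal_cone (maximizers x)) = [set y | maximizers y = maximizers x].
Proof.
have eq0 t u y : t \in maximizers x -> u \in maximizers x -> r t u ->
    affine_hull (normal_cone (maximizers x)) y -> dot (v t - v u) y = 0.
  move=> tx ux tu; apply: affine_hull_dot_eq0 => z /fintype.subsetP xz.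
  by apply/eqP; rewrite -mem_maximizers ?xz.
apply/seteqP; split => y.
  move=> [xy hy]; apply/eqP; rewrite finset.eqEsubset; apply/andP; split => //.
  have [c c0 hc] := nbhs_ray (y - x) hy.
  have xc : normal_cone (maximizers x) (y + c *: (y - x)).
    apply: hc; have -> : y + c *: (y - x) = y + (- c) *: (x - y).
      by rewrite scaleNr -scalerN opprB.
    by apply: affine_hull_line => //; exact: fintype.subxx.
  apply/fintype.subsetP => t ty; apply: contraT => /notin_maximizers.
  set u := top x t => ux.
  have xu : u \in maximizers x := top_max x t.
  have tu : r t u := top_rel x t.
  have tuy : dot (v t - v u) y = 0.
    by apply/eqP; rewrite -mem_maximizers// (fintype.subsetP xy).
  have := maximizer_le (fintype.subsetP xc _ xu) tu.
  rewrite dotDr dotZr dotBr tuy add0r sub0r mulrN oppr_le0.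
  by rewrite pmulr_rge0// dotBl subr_ge0 leNgt -subr_gt0 -dotBl ux.
move=> /= yx; split; first by rewrite /normal_cone /= yx.
rewrite -yx in eq0 *; apply: filterS (near_maximizers y) => z zy hz.
rewrite /normal_cone /=; apply/fintype.subsetP => t ty.
have tz := fintype.subsetP zy _ (top_max z t).
by rewrite (mem_maximizers (top_max z t) (top_rel z t)) eq0.
Qed.

Section Generic.
Variable x : 'rV[R]_n.
Hypothesis x_generic : generic_for x.

(** Nearby points can only lose maximizers, but each class keeps one, and at a generic [x] it has
    only one. *)
Lemma near_generic : \forall y \near x, maximizers y = maximizers x.
Proof.
apply: filterS (near_maximizers x) => y yx; apply/eqP; rewrite finset.eqEsubset yx.
apply/fintype.subsetP => t tx.
by rewrite (x_generic tx (fintype.subsetP yx _ (top_max y t)) (top_rel y t)).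
Qed.

Lemma open_polyhedral_generic :
  open_polyhedral_cone [set y | maximizers y = maximizers x].
Proof.
exists [seq v p.1 - v p.2 | p <-
  enum [pred p | [&& p.1 \in maximizers x, r p.1 p.2 & p.1 != p.2]]].
  apply/mapP => -[[t u]]; rewrite mem_enum inE /= => /and3P[_ tu t_neq_u].
  by move=> /esym/eqP; rewrite subr_eq0 => /eqP/(v_inj tu)/eqP; apply/negP.
have generic_notin t u : t \in maximizers x -> r t u -> t != u -> u \notin maximizers x.
  by move=> tx tu; apply: contra => /(x_generic tx)/(_ tu) ->.
apply/seteqP; split => y /=.
  move=> yx _ /mapP[[t u] + ->]; rewrite mem_enum inE /= => /and3P[tx tu t_neq_u].
  rewrite -opprB -scaleN1r dotZl mulN1r oppr_gt0 lt_neqAle -mem_maximizers.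
  - by rewrite maximizer_le ?yx// 1?r_sym// andbT (generic_notin t).
  - by rewrite yx.
  - by rewrite r_sym.
move=> h; have gt0 t u : t \in maximizers x -> r t u -> t != u -> 0 < dot (v t - v u) y.
  move=> tx tu t_neq_u; apply/h/mapP; exists (t, u) => //.
  by rewrite mem_enum inE /= tx tu.
apply/eqP; rewrite finset.eqEsubset; apply/andP; split; apply/fintype.subsetP => t.
  move=> /maximizersP ty; have [->|tu] := eqVneq t (top x t); first exact: top_max.
  have := gt0 _ t (top_max x t); rewrite r_sym eq_sym tu top_rel => /(_ isT isT).
  by rewrite dotBl subr_gt0 ltNge ty// top_rel.
move=> tx; apply/maximizersP => u tu; have [->//|t_neq_u] := eqVneq t u.
by rewrite ltW// -subr_gt0 -dotBl gt0.
Qed.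

(** For [y] in the closed cone, [y + c *: x] tends to [y] and by [normal_coneD] has just the
    maximizers of [x]. *)
Lemma closure_generic :
  closure [set y | maximizers y = maximizers x] = normal_cone (maximizers x).
Proof.
apply/seteqP; split => y.
  move=> xy; rewrite /normal_cone /=.
  have [z [<- zy]] := xy _ (near_maximizers y).
  exact: zy.
move=> /fintype.subsetP xy B /(nbhs_ray x)[c c0 Bc]; exists (y + c *: x); split => //=.
have h : normal_cone (maximizers x) (c *: x) by rewrite /normal_cone /= maximizersZ.
rewrite (normal_coneD _ h) ?maximizersZ//; last exact/fintype.subsetP.
by apply/finset.setIidPr/fintype.subsetP.
Qed.

End Generic.

Lemma complete_normal_fan : complete_polyhedral_fan normal_fan.
Proof.
split; last by apply/seteqP; split=> // x _; 
    exists (normal_cone (maximizers x)); [exists x|exact: fintype.subxx].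
have self x : normal_cone (maximizers x) x by exact: fintype.subxx.
split.
- apply: (@sub_finite_set _ _ (range normal_cone)).
    by move=> _ [x _ <-]; exists (maximizers x).
  exact/finite_image/finite_finset.
- move=> _ [x _ <-]; split; first exact: polyhedral_normal_cone.
  by exists x.
- move=> _ F [x _ <-] xF F0; have [y _ ->] := face_normal_cone xF F0.
  by exists y.
- have face x y : is_face (normal_cone (maximizers x) `&` normal_cone (maximizers y))
    (normal_cone (maximizers x)) by exact: face_normal_coneI.
  by move=> _ _ [x _ <-] [y _ <-]; split; [|rewrite setIC].
Qed.

(* A generic direction shrinks the set of maximizers to a subset, so every cone
   of the fan is a face of the cone of a generic point. *)
Lemma normal_fan_generic_faces :
  normal_fan = [set F | F !=set0 /\
    exists2 x, generic_for x & is_face F (normal_cone (maximizers x))].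
Proof.
apply/seteqP; split => [_ [x _ <-]|F [F0 [x _ xF]]]; last first.
  by have [y _ ->] := face_normal_cone xF F0; exists y.
split; first by exists x; exact: fintype.subxx.
have [y y_generic yx] := exists_generic x; exists y => //.
rewrite [X in is_face X](_ :
    _ = normal_cone (maximizers y) `&` normal_cone (maximizers x)).
  exact: face_normal_coneI.
by apply/esym/setIidr => z; exact: fintype.subset_trans.
Qed.

End NormalFan.


(** * Reachability and directed paths in a DAG *)

Section Dag.
Set Implicit Arguments.
Unset Strict Implicit.
Context {V : finType} (e : rel V).
Hypothesis e_acyclic : acyclic e.
Implicit Types (i j k x y : V) (p q : seq V).

Lemma dpath_loop i p : dpath e i i p -> p = [::].
Proof.
case/lastP: p => // p x /andP[ip]; rewrite last_rcons => /eqP xi.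
by rewrite xi in ip; have := @e_acyclic (i :: p) ip.
Qed.

Lemma dpath_cat i j k p q : dpath e i j p -> dpath e j k q -> dpath e i k (p ++ q).
Proof. by move=> /andP[ip /eqP ij]; rewrite /dpath cat_path last_cat ip ij. Qed.

Lemma dpath_cons i j x p : dpath e i j (x :: p) = e i x && dpath e x j p.
Proof. by rewrite /dpath /= andbA. Qed.

Lemma connect_dpath i j : reflect (exists p, dpath e i j p) (connect e i j).
Proof.
apply: (iffP connectP) => [[p ip ->]|[p /andP[ip /eqP <-]]]; exists p => //.
by rewrite /dpath ip eqxx.
Qed.

Lemma connect_antisym i j : connect e i j -> connect e j i -> i = j.
Proof.
move=> /connect_dpath[p ip] /connect_dpath[q jq].
have := dpath_loop (dpath_cat ip jq); case: p ip => // /andP[_ /eqP] //.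
Qed.

Lemma edge_not_connect i x : e i x -> ~~ connect e x i.
Proof.
move=> ix; apply/negP => /connect_dpath[p xp].
have : dpath e i i (x :: p) by rewrite dpath_cons ix.
by move/dpath_loop.
Qed.

Lemma connect_belast i p k : path e i p -> k \in belast i p -> connect e i k.
Proof.
by move=> ip /mem_belast; exact: path_connect. Qed.

Lemma dpath_uniq i p : path e i p -> uniq (i :: p).
Proof.
elim: p i => //= x p IH i /andP[ix xp]; rewrite (IH x xp) andbT.
exact: contra (@path_connect _ _ _ _ xp i) (edge_not_connect ix).
Qed.

Lemma dpath_size i p : path e i p -> (size p <= #|V|)%N.
Proof. by move=> /dpath_uniq/card_uniqP/= sp; rewrite ltnW// -sp max_card. Qed.

(** This serves to show that a path avoids the ancestors of any node that its first step [x] does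
    not reach. *)
Lemma interior_not_connect i j x p k : dpath e i j (x :: p) ->
  k \in interior_nodes i (x :: p) -> connect e x k.
Proof. by rewrite dpath_cons => /andP[_ /andP[xp _]]; exact: connect_belast. Qed.

End Dag.

(** * Path weights as linear functionals *)

Section PathVectors.
Set Implicit Arguments.
Unset Strict Implicit.
Local Open Scope ring_scope.
Import Order.TTheory GRing.Theory Num.Theory.
Context {R : realType} {V : finType} (e : rel V).
Implicit Types (i j k x y : V) (p q : seq V) (C : weights R e).

(** Counting multiplicities makes the vector additive along a path; a path of a DAG repeats no edge,
    so there it is the 0/1 indicator. *)
Definition path_vector i p : weights R e :=
  \row_k (count_mem (val (enum_val k)) (zip (belast i p) p))%:R.

Lemma entryE C i j (ij : e i j) :
  entry C i j = (C 0 (enum_rank (Sub (i, j) ij : Defs.arc e)))%:E.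
Proof. by rewrite /entry insubT. Qed.

Lemma path_weightE C i p : path e i p ->
  path_weight C i p = (dot (path_vector i p) C)%:E.
Proof.
elim: p i => [|x p IH] i /=.
  rewrite /path_weight big_nil (_ : path_vector i [::] = 0) ?dot0l//.
  by apply/rowP => k; rewrite !mxE.
move=> /andP[ix xp]; rewrite /path_weight /= big_cons [X in (_ + X)%E]IH//= entryE.
rewrite -EFinD; congr EFin.
rewrite /dot (bigD1 (enum_rank (Sub (i, x) ix : Defs.arc e)))//=.
rewrite [in RHS](bigD1 (enum_rank (Sub (i, x) ix : Defs.arc e)))//=.
rewrite !mxE /= enum_rankK /= eqxx natrD mulrDl mul1r addrA; congr (_ + _ + _).
apply: eq_bigr => k kix; rewrite !mxE /=.
rewrite (_ : _ == _ = false)//; apply: contra_neqF kix => /eqP kix.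
by rewrite -[k]enum_valK; congr enum_rank; apply/val_inj; rewrite /= -kix.
Qed.

Hypothesis e_acyclic : acyclic e.

(** If the paths diverge at [i], equal vectors force the edge from [i] to [x] to occur later in the
    other path, which would then return to [i]. *)
Lemma path_vector_inj i j p q : dpath e i j p -> dpath e i j q ->
  path_vector i p = path_vector i q -> p = q.
Proof.
elim: p i q => [|x p IH] i q.
  by rewrite {1}/dpath /= => /eqP -> /(dpath_loop e_acyclic) ->.
case: q => [|y q].
  by move=> h /andP[_ /eqP/= ij]; rewrite -ij in h; move/(dpath_loop e_acyclic): h.
rewrite !dpath_cons => /andP[ix xp] /andP[iy yq] /rowP pq.
have [xy|xy] := eqVneq x y.
  rewrite -{y}xy in pq iy yq *; congr cons; apply: (IH _ _ xp yq).
  apply/rowP => k; have := pq k; rewrite !mxE /= !natrD => /addrI; exact.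
have := pq (enum_rank (Sub (i, x) ix : Defs.arc e)).
rewrite !mxE enum_rankK /= eqxx xpair_eqE eqxx eq_sym (negbTE xy) add0n.
rewrite [X in _ = X%:R](_ : _ = 0)%N; first by move=> /eqP; rewrite pnatr_eq0.
apply/count_memPn; apply: contra (edge_not_connect e_acyclic iy).
case/andP: yq => yq _ ixq; apply: (connect_belast yq).
have := map_f fst ixq; rewrite -/(unzip1 _) unzip1_zip ?size_belast//.
Qed.

End PathVectors.


(** * Maxoids and critical paths of generic matrices *)

Section GenericMaxoids.
Set Implicit Arguments.
Unset Strict Implicit.
Context {R : realType} {V : finType} (e : rel V).
Hypothesis e_acyclic : acyclic e.
Implicit Types (i j k x y : V) (p q : seq V) (L : {set V}) (C : weights R e).

Lemma critical_behead C i j x p : critical C i j (x :: p) -> critical C x j p.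
Proof.
move=> []; rewrite dpath_cons => /andP[ix xp] max_xp; split=> // q xq.
have := max_xp (x :: q); rewrite dpath_cons ix => /(_ xq).
by rewrite /path_weight /= !big_cons entryE leeD2lE.
Qed.

Lemma generic_critical_inj C i j p q : generic C ->
  critical C i j p -> critical C i j q -> p = q.
Proof.
move=> C_generic ip iq; have [ij|ij] := eqVneq i j.
  move: ip iq => [+ _] [+ _]; rewrite ij.
  by move=> /(dpath_loop e_acyclic) -> /(dpath_loop e_acyclic) ->.
have [|r [_ r_uniq]] := C_generic i j ij; first by exists p; case: ip.
by rewrite -(r_uniq p)// -(r_uniq q).
Qed.

Lemma critical_dag_connect C L i j : critical_dag C L i j -> i != j /\ connect e i j.
Proof. by move=> [ij ex_p _]; split => //; apply/connect_dpath. Qed.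

Lemma subset_maxoid C C' :
  (forall i j p, critical C i j p -> critical C' i j p) -> maxoid C `<=` maxoid C'.
Proof.
move=> sub [[A B] L] [disj sep]; split => // i j iA jB; have := sep i j iA jB.
apply: contra_not.
have dag x y : critical_dag C' L x y -> critical_dag C L x y.
  by move=> [xy ex_p h]; split=> // p /sub; exact: h.
have cpath x y : cstar_path C' L x y -> cstar_path C L x y.
  case=> [/dag|[p [pL xpy /dag px /dag py]]|[l [lL xly /dag xl /dag yl]]|].
  - exact: Or41.
  - by apply: Or42; exists p.
  - by apply: Or43; exists l.
  - case=> [[p [l [pl [/dag a /dag b /dag c]]]]|]; first by apply: Or44; left; exists p, l.
    move=> [p [l [q [plq [/dag a /dag b /dag c /dag d]]]]].
    by apply: Or44; right; exists p, l, q.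
by case=> /cpath; [left|right].
Qed.

(* The separating set consists of x' and its ancestors other than i.  Ancestor
   closedness rules out all paths (b)-(e), and the critical path from i to j
   avoids the set in C but starts with x' in C'. *)
Lemma maxoid_separates_first_step C C' i j x p x' p' : generic C -> generic C' ->
  critical C i j (x :: p) -> critical C' i j (x' :: p') -> ~~ connect e x x' ->
  ~ maxoid C' `<=` maxoid C.
Proof.
move=> C_generic C'_generic xp xp' xx'.
have [ix xj] : e i x /\ connect e x j.
  case: xp => + _; rewrite dpath_cons => /andP[ix xp]; split=> //.
  by apply/connect_dpath; exists p.
have [ix' x'j] : e i x' /\ connect e x' j.
  case: xp' => + _; rewrite dpath_cons => /andP[ix' xp']; split=> //.
  by apply/connect_dpath; exists p'.
pose L := finset (fun k => connect e k x' && (k != i)).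
have inL k : (k \in L) = connect e k x' && (k != i) by rewrite inE.
have ij : connect e i j := connect_trans (connect1 ix) xj.
have i_neq_j : i != j by apply: contraTneq xj => <-; exact: edge_not_connect.
have iL : i \notin L by rewrite inL eqxx andbF.
have jL : j \notin L by rewrite inL (contraNF (connect_trans xj) xx').
have x'L : x' \in L.
  rewrite inL connect0; apply: contraTneq ix' => ->.
  by apply/negP => /(edge_not_connect e_acyclic); rewrite connect0.
have disj k k' : k != k' -> [disjoint [set k]%SET & [set k']%SET]%B.
  by rewrite disjoints1 inE.
have disjL k : k \notin L -> [disjoint [set k]%SET & L]%B by rewrite disjoints1.
(* Closure of [L] under ancestors other than [i]; in particular [j] does not point into [L]. *)
have up k l : critical_dag C' L k l -> l \in L -> k != i -> k \in L.
  move=> /critical_dag_connect[_ kl]; rewrite !inL => /andP[lx' _] ->.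
  by rewrite (connect_trans kl lx').
(* A proper ancestor of [i] is also one of [x'], so no node outside [L] points to [i]. *)
have to_i k : critical_dag C' L k i -> k \in L.
  move=> /critical_dag_connect[ki_neq ki].
  by rewrite inL ki_neq (connect_trans ki (connect1 ix')).
have sep : maxoid C' ([set i]%SET, [set j]%SET, L).
  split; first by split; [exact: disj|exact: disjL|exact: disjL].
  move=> _ _ /set1P -> /set1P -> []; case.
  (* Form (a): [x'] is in [L], and it is interior to the critical path because [j] is not in [L]. *)
  - move=> [_ _ /(_ _ xp' x') h]; have := x'L; apply/negP/h.
    case: (p') (xp') => [|y q _]; last by rewrite inE eqxx.
    by move=> [/andP[_ /= /eqP x'_eq_j]] _; rewrite x'_eq_j (negbTE jL) in x'L.
  - by move=> [k [kL _ /to_i]]; rewrite (negbTE kL).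
  - by move=> [l [lL _ _ /up/(_ lL)]]; rewrite eq_sym => /(_ i_neq_j); rewrite (negbTE jL).
  - case=> [[k [l [[kL _ _] [/to_i]]]]|]; first by rewrite (negbTE kL).
    by move=> [k [l [q [[kL _ _ _] [/to_i]]]]]; rewrite (negbTE kL).
  - move=> /critical_dag_connect[_ ji].
    by move: i_neq_j; rewrite (connect_antisym e_acyclic ij ji) eqxx.
  - by move=> [k [kL _ _ /to_i]]; rewrite (negbTE kL).
  - by move=> [l [lL _ /up/(_ lL)]]; rewrite eq_sym => /(_ i_neq_j); rewrite (negbTE jL).
  - case=> [[k [l [[kL lL]]]]|].
      rewrite /= !inE !negb_or => /and3P[_ /andP[_ k_neq_i] _] [_ /up/(_ lL k_neq_i)].
      by rewrite (negbTE kL).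
    by move=> [k [l [q [[_ _ qL _] [_ _ _ /to_i]]]]]; rewrite (negbTE qL).
move=> /(_ _ sep)[_ /(_ i j)]; rewrite !inE !eqxx => /(_ isT isT).
apply; left; apply: Or41.
split=> //; first exact/connect_dpath.
(* [x] reaches every interior node of the only critical path and every node of [L] reaches [x'], so
   a common node would connect [x] to [x']. *)
move=> q /(generic_critical_inj C_generic xp) <- k.
have [ijxp _] := xp; move=> /(interior_not_connect ijxp) xk.
by rewrite inL negb_and (contra (connect_trans xk) xx').
Qed.

(** The end points may coincide so that the induction along the path can reach the empty one. Where
    the first steps differ, the matrices swap roles according to which step fails to reach the
    other. *)
Lemma generic_maxoid_critical C C' i j p p' : generic C -> generic C' ->
  maxoid C = maxoid C' -> critical C i j p -> critical C' i j p' -> p = p'.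
Proof.
move=> C_generic C'_generic CC'; elim: p i p' => [|x p IH] i p' ip ip'.
  move: ip ip' => [/andP[_ /eqP/= ij] _] [+ _].
  by rewrite ij => /(dpath_loop e_acyclic).
case: p' ip' => [|x' p'] ip'.
  move: ip ip' => [+ _] [/andP[_ /eqP/= ij] _].
  by rewrite ij => /(dpath_loop e_acyclic).
have [xx'|x_neq_x'] := eqVneq x x'.
  rewrite -xx' in ip' *; congr cons.
  exact: IH (critical_behead ip) (critical_behead ip').
have [xx'|xx'] := boolP (connect e x x'); last first.
  by have [] := maxoid_separates_first_step C_generic C'_generic ip ip' xx'; rewrite CC'.
have x'x : ~~ connect e x' x.
  by apply: contra x_neq_x' => x'x; rewrite (connect_antisym e_acyclic xx' x'x).
by have [] := maxoid_separates_first_step C'_generic C_generic ip' ip x'x; rewrite CC'.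
Qed.

End GenericMaxoids.


(** * The fan of maxoid cones as a normal fan of path polytopes *)

Section MaxoidFan.
Set Implicit Arguments.
Unset Strict Implicit.
Local Open Scope ring_scope.
Import Order.TTheory GRing.Theory Num.Theory numFieldNormedType.Exports.
Context {R : realType} {V : finType} (e : rel V).
Hypothesis e_acyclic : acyclic e.
Implicit Types (i j k x y : V) (p q : seq V) (C : weights R e).

(* Bounding the length by #|V| makes this a finType; it loses no path of a DAG. *)
Definition proper_path : finType :=
  {t : V * {bseq #|V| of V} | path e t.1 t.2 && (t.1 != last t.1 t.2)}.

Definition source (t : proper_path) : V := (val t).1.
Definition nodes (t : proper_path) : seq V := (val t).2.
Definition target (t : proper_path) : V := last (source t) (nodes t).

(** The classes are the sets [P(i, j)], one for each summand of the Minkowski sum. *)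
Definition parallel (t u : proper_path) : bool :=
  (source t == source u) && (target t == target u).

Definition proper_path_vector (t : proper_path) : weights R e :=
  path_vector e (source t) (nodes t).

Local Notation crit := (maximizers parallel proper_path_vector).
Local Notation crit_generic := (generic_for parallel proper_path_vector).

Lemma parallel_refl : reflexive parallel.
Proof. by move=> t; rewrite /parallel !eqxx. Qed.

Lemma parallel_sym : symmetric parallel.
Proof. by move=> t u; rewrite /parallel eq_sym [target t == _]eq_sym. Qed.

Lemma parallel_trans : transitive parallel.
Proof.
move=> u t w /andP[/eqP tu /eqP tu'] /andP[/eqP uw /eqP uw'].
by rewrite /parallel tu tu' uw uw' !eqxx.
Qed.

Lemma proper_path_neq t : source t != target t.
Proof. by have /andP[] := valP t. Qed.

Lemma dpath_proper_path t : dpath e (source t) (target t) (nodes t).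
Proof. by have /andP[tp _] := valP t; rewrite /dpath tp eqxx. Qed.

Lemma proper_path_of i j p : i != j -> dpath e i j p ->
  exists t, [/\ source t = i, target t = j & nodes t = p].
Proof.
move=> ij /andP[ip /eqP ipj]; have sp := dpath_size e_acyclic ip.
have tP : path e (i, Bseq sp).1 (i, Bseq sp).2 &&
    ((i, Bseq sp).1 != last (i, Bseq sp).1 (i, Bseq sp).2).
  by rewrite /= ip ipj.
by exists (Sub (i, Bseq sp) tP); split.
Qed.

Lemma proper_path_vector_inj t u : parallel t u ->
  proper_path_vector t = proper_path_vector u -> t = u.
Proof.
move=> /andP[/eqP tu /eqP tu'] vec_tu.
have nodes_tu : nodes t = nodes u.
  apply: (path_vector_inj (R := R) e_acyclic (dpath_proper_path t)).
    by rewrite tu tu'; exact: dpath_proper_path.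
  by rewrite [LHS]vec_tu /proper_path_vector tu.
apply/val_inj/eqP; rewrite -pair_eqE /pair_eq /= -/(source t) tu eqxx.
by apply/eqP/val_inj.
Qed.

Lemma maximizers_critical C t :
  t \in crit C <-> critical C (source t) (target t) (nodes t).
Proof.
have t_path u : path e (source u) (nodes u) by have /andP[] := dpath_proper_path u.
split => [/maximizersP t_max|[_ t_max]].
  split=> [|q tq]; first exact: dpath_proper_path.
  have [u [su tu nu]] := proper_path_of (proper_path_neq t) tq.
  rewrite -nu -{1}su !path_weightE// lee_fin.
  by apply: t_max; rewrite /parallel su tu !eqxx.
apply/maximizersP => u /andP[/eqP su /eqP tu].
by rewrite -lee_fin -!path_weightE// -su t_max// su tu dpath_proper_path.
Qed.

Lemma critical_proper_path C i j p : i != j -> critical C i j p ->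
  exists t, [/\ source t = i, target t = j, nodes t = p & t \in crit C].
Proof.
move=> ij ip; have [t [si tj np]] := proper_path_of ij (proj1 ip).
by exists t; split=> //; apply/maximizers_critical; rewrite si tj np.
Qed.

Lemma subset_maximizers_critical C C' : crit C \subset crit C' ->
  forall i j p, critical C i j p -> critical C' i j p.
Proof.
move=> /fintype.subsetP sub i j p; have [->|ij] := eqVneq i j.
  (* Equal end points fall outside [proper_path], but then the empty path is the only one. *)
  move=> [jp _]; split => // q /(dpath_loop e_acyclic) ->.
  by rewrite (dpath_loop e_acyclic jp).
by move=> /(critical_proper_path ij)[t [<- <- <- /sub/maximizers_critical]].
Qed.

Lemma generic_forP C : crit_generic C <-> generic C.
Proof.
split=> [C_generic i j ij [p ip]|C_generic t u].
  have [t [si tj _]] := proper_path_of ij ip.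
  have [u tu uC] := exists_maximizer proper_path_vector parallel_refl parallel_trans C t.
  have [/eqP su /eqP eu] := andP tu; rewrite si in su; rewrite tj in eu.
  exists (nodes u); split=> [|q iq]; first by rewrite su eu; exact/maximizers_critical.
  have [w [sw tw <- wC]] := critical_proper_path ij iq.
  by rewrite (C_generic u w)// /parallel sw tw su eu !eqxx.
move=> /maximizers_critical tC /maximizers_critical uC /[dup] tu /andP[/eqP su /eqP eu].
apply: proper_path_vector_inj => //; rewrite /proper_path_vector -su.
by congr path_vector; rewrite -su -eu in uC; exact: generic_critical_inj tC uC.
Qed.

Lemma generic_maximizers C C' : crit C' = crit C -> generic C -> generic C'.
Proof. by move=> CC' /generic_forP; rewrite /generic_for -CC' => /generic_forP. Qed.

(** This identifies the generic matrices of a given maxoid with the interior of a maximal normal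
    cone. *)
Lemma eq_maxoidP C C' : generic C -> generic C' ->
  maxoid C = maxoid C' <-> crit C = crit C'.
Proof.
move=> C_generic C'_generic; split=> [CC'|CC']; last first.
  by apply/seteqP; split; apply: (subset_maxoid (e := e));
    apply: subset_maximizers_critical; rewrite CC'.
have sub C1 C2 : generic C1 -> generic C2 -> maxoid C1 = maxoid C2 ->
    crit C1 \subset crit C2.
  move=> C1_generic C2_generic C12; apply/fintype.subsetP => t tC1.
  apply/maximizers_critical; move/maximizers_critical: tC1 => tC1.
  have [|q [qC2 _]] := C2_generic _ _ (proper_path_neq t).
    by exists (nodes t); exact: dpath_proper_path.
  by rewrite (generic_maxoid_critical e_acyclic C1_generic C2_generic C12 tC1 qC2).
by apply/eqP; rewrite finset.eqEsubset !sub.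
Qed.

Lemma setC_critical_locus :
  ~` critical_locus (path_ties e) = [set C : weights R e | generic C].
Proof.
apply/seteqP; split=> C /=.
  move=> h; apply/generic_forP => t u /maximizers_critical tC /maximizers_critical uC tu.
  apply: contra_notP h => t_neq_u.
  have [/eqP su /eqP eu] := andP tu; rewrite -su -eu in uC.
  have nodes_neq : nodes t != nodes u.
    apply: contra_notN t_neq_u => /eqP tu_nodes; apply: proper_path_vector_inj => //.
    by rewrite /proper_path_vector su tu_nodes.
  exists (source t), (target t), (nodes t), (nodes u); split=> //.
  - exact: proper_path_neq.
  - exists (source t), (target t), (nodes t), (nodes u); split=> //.
    + exact: proper_path_neq.
    + exact: dpath_proper_path.
    + by case: uC.
move=> C_generic [i [j [p [q [_ /eqP p_neq_q ip iq _]]]]].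
exact/p_neq_q/(generic_critical_inj e_acyclic C_generic ip iq).
Qed.

Lemma hyperplane_arrangement_path_ties :
  hyperplane_arrangement (path_ties e : set (set (weights R e))).
Proof.
split.
  apply: (@sub_finite_set _ _ (range (fun tu : proper_path * proper_path =>
      tie (source tu.1) (nodes tu.1) (nodes tu.2)))); last first.
    exact/finite_image/finite_finset.
  move=> _ [i [j [p [q [ij ip iq _ ->]]]]].
  have [t [si _ np]] := proper_path_of ij ip; have [u [_ _ nq]] := proper_path_of ij iq.
  by exists (t, u) => //=; rewrite si np nq.
move=> _ [i [j [p [q [ij ip iq p_neq_q ->]]]]].
exists (path_vector e i p - path_vector e i q).
  rewrite subr_eq0; apply: contra p_neq_q => /eqP pq; apply/eqP.
  exact: (path_vector_inj e_acyclic ip iq pq).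
have [[ip' _] [iq' _]] := (andP ip, andP iq).
apply/seteqP; split=> C; rewrite /tie /= !path_weightE// dotBl.
  by move=> [->]; rewrite subrr.
by move=> /eqP; rewrite subr_eq0 => /eqP ->.
Qed.

Section Cones.
Variable HG : set (weights R e).
Hypothesis HG_generic : ~` HG = [set C | generic C].

Let genericE C : (~ HG C) = generic C.
Proof. exact: (congr1 (fun A : set (weights R e) => A C) HG_generic). Qed.

Lemma maxoid_coneE C : generic C -> maxoid_cone HG C = [set C' | crit C' = crit C].
Proof.
move=> C_generic; apply/seteqP; split=> C' /=.
  by rewrite /maxoid_cone /= genericE => -[C'_generic /eq_maxoidP ->].
move=> CC'; have C'_generic := generic_maximizers CC' C_generic.
by split; [rewrite genericE|exact/eq_maxoidP].
Qed.

(** The closures of the maxoid cones are the normal cones at generic points, and the faces of these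
    make up the whole normal fan. *)
Lemma maxoid_fanE : maxoid_fan HG = normal_fan parallel proper_path_vector.
Proof.
rewrite (normal_fan_generic_faces parallel_refl parallel_sym parallel_trans
  proper_path_vector_inj).
have closureE C : generic C -> closure (maxoid_cone HG C) =
    normal_cone parallel proper_path_vector (crit C).
  move=> C_generic; rewrite maxoid_coneE// closure_generic//.
  - exact: parallel_refl.
  - exact: parallel_sym.
  - exact: parallel_trans.
apply/seteqP; split=> F [F0 [C C_generic CF]]; split=> //; exists C.
- by rewrite genericE in C_generic; exact/generic_forP.
- by rewrite genericE in C_generic; rewrite -closureE.
- by rewrite genericE; exact/generic_forP.
- by rewrite closureE//; exact/generic_forP.
Qed.

End Cones.

End MaxoidFan.

Theorem mainTheorem1 (R : realType) (V : finType) (e : rel V)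
    (e_acyclic : acyclic e) :
  exists (A : set (set (weights R e))) (HG : set (weights R e)),
    [/\ hyperplane_arrangement A, A `<=` path_ties e &
        HG = critical_locus A /\ ~` HG = [set C | generic C]] /\
    [/\ forall C, ~ HG C ->
          open_polyhedral_cone (maxoid_cone HG C) /\
          full_dimensional (maxoid_cone HG C),
        complete_polyhedral_fan (maxoid_fan HG) &
        exists Phi : set (weights R e) -> set (ci_statement V),
          [/\ forall F, maxoid_fan HG F ->
                relative_interior F !=set0 /\
                (forall C, relative_interior F C -> Phi F = maxoid C),
              Phi @` maxoid_fan HG = range (fun C : weights R e => maxoid C) &
              forall F1 F2, maxoid_fan HG F1 -> maxoid_fan HG F2 ->
                is_face F1 F2 -> Phi F2 `<=` Phi F1]].
Proof.
have locusE := @setC_critical_locus R V e e_acyclic.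
exists (path_ties e), (critical_locus (path_ties e)); split.
  by split=> //; exact: hyperplane_arrangement_path_ties.
pose r := @parallel V e; pose v := @proper_path_vector R V e.
have r_refl : reflexive r := @parallel_refl V e.
have r_sym : symmetric r := @parallel_sym V e.
have r_trans : transitive r := @parallel_trans V e.
have v_inj t u : r t u -> v t = v u -> t = u by exact: proper_path_vector_inj.
rewrite (maxoid_fanE e_acyclic locusE); split.
- move=> C C_notin; have C_generic : generic C.
    by rewrite -[generic C]/([set C | generic C] C) -locusE.
  have /generic_forP C_generic_for := C_generic.
  rewrite (maxoid_coneE e_acyclic locusE)//; split.
    by apply: open_polyhedral_generic => //; exact: C_generic_for.
  by apply: nbhs_full_dimensional; apply: near_generic => //; exact: C_generic_for.
- exact: complete_normal_fan.
have relintE C : relative_interior (normal_cone r v (maximizers r v C)) =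
    [set C' | maximizers r v C' = maximizers r v C].
  exact: relative_interior_normal_cone.
have maxoid_sub C C' : maximizers r v C \subset maximizers r v C' ->
    maxoid C `<=` maxoid C'.
  by move=> sub; apply: subset_maxoid; exact: subset_maximizers_critical.
(* The union of the maxoids over the relative interior avoids choosing a point; the maxoid is
   constant there. *)
pose Phi F : set (ci_statement V) :=
  [set s | exists2 C : weights R e, relative_interior F C & maxoid C s].
have PhiE C : Phi (normal_cone r v (maximizers r v C)) = maxoid C.
  rewrite /Phi relintE; apply/seteqP; split=> [s [C' /= CC']|s sC]; last by exists C.
  by apply: maxoid_sub; rewrite CC'.
exists Phi; split.
- move=> _ [C _ <-]; rewrite relintE PhiE; split; first by exists C.
  by move=> C' /= CC'; apply/seteqP; split; apply: maxoid_sub; rewrite CC'.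
(* Surjectivity: every [C], generic or not, has its own cone in the normal fan. *)
- apply/seteqP; split=> [_ [_ [C _ <-] <-]|_ [C _ <-]]; first by exists C.
  by exists (normal_cone r v (maximizers r v C)) => //; exists C.
- move=> _ _ [C1 _ <-] [C2 _ <-] [a [b [_ C12]]]; rewrite !PhiE.
  (* As the face contains [C1], so does the cone of [C2], which says that the maximizers of [C2] are
     among those of [C1]. *)
  apply: maxoid_sub.
  have : normal_cone r v (maximizers r v C1) C1 by exact: fintype.subxx.
  by rewrite C12 => -[].
Qed.
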